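(* Let $G$ be a finite metabelian group and $H$ a normal subgroup of $G$. Then $H$ is a perfect code of $G$ if and only if it has a Sylow $2$-subgroup which is a perfect code of $G$.
   Context: For a finite group $G$ with identity $1$ and a subset $S\subseteq G\setminus\{1\}$ with $S^{-1}=S$ (possibly $S=\emptyset$), the Cayley graph $\mathrm{Cay}(G,S)$ has vertex set $G$, with $x,y$ adjacent if and only if $yx^{-1}\in S$. A perfect code in a graph $\Gamma$ with vertex set $V$ is a subset $C\subseteq V$ such that no two vertices of $C$ are adjacent and every vertex in $V\setminus C$ is adjacent to exactly one vertex in $C$. A subset (in particular a subgroup) $C$ of $G$ is called a perfect code of $G$ if there exists such an $S$ for which $C$ is a perfect code in $\mathrm{Cay}(G,S)$. A group is metabelian if its commutator subgroup is Abelian. *)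

(* Defs.v *)
From mathcomp Require Import all_boot all_fingroup all_solvable.

Set Implicit Arguments.
Unset Strict Implicit.
Unset Printing Implicit Defensive.

Local Open Scope group_scope.

(* [V] is the vertex set and [e] the adjacency relation, to be read as a
   loopless undirected graph on [V]; [e] is only inspected on [V]. *)
Definition perfect_code_in (T : finType) (V : {set T}) (e : rel T)
    (C : {set T}) : Prop :=
  [/\ C \subset V,
      {in C &, forall x y, ~~ e x y}
    & {in V :\: C, forall x, #|[set y in C | e x y]| = 1%N}].

Definition connection_set (gT : finGroupType) (G S : {set gT}) : Prop :=
  S \subset G^# /\ S^-1 = S.

Definition cayley_adj (gT : finGroupType) (S : {set gT}) : rel gT :=
  fun x y => y * x^-1 \in S.

Definition perfect_code (gT : finGroupType) (G C : {set gT}) : Prop :=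
  exists2 S : {set gT}, connection_set G S
    & perfect_code_in G (cayley_adj S) C.

Definition metabelian (gT : finGroupType) (G : {set gT}) : Prop :=
  abelian [~: G, G].

(* Main.v *)
Require Import Defs.
From mathcomp Require Import all_boot all_fingroup all_solvable.

Set Implicit Arguments.
Unset Strict Implicit.

Local Open Scope group_scope.

(** A set S witnesses that a subgroup H is a perfect code of G exactly when it
    is an inverse-closed transversal of the nontrivial left cosets of H in G.
    This transversal can be built one double coset at a time.
    Inside D = HxH every left coset meets every right coset, so two uncovered
    left cosets aH and bH with b^-1 in HaH can be covered together, by an
    element of aH whose inverse lies in bH.  The only obstruction is parity: D
    inverse-closed, with an odd number of left cosets, forces the transversal
    to contain an involution of D; conversely such an involution suffices.
    This is [perfect_code_dcoset].

    If H is normal, or if H is a 2-group, a double coset with an odd number of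
    left cosets is a single coset xH with x normalising H.  So in both cases H
    is a perfect code of G iff every x in N_G(H) with x^2 in H has a square
    root of 1 in xH ([perfect_code_sqr]).

    Let P be a Sylow 2-subgroup of the normal subgroup H.  Suppose that H is a
    perfect code, and let x normalise P with x^2 in P.  Then R = P<x> is a
    2-group meeting H in P, hence a Sylow 2-subgroup of RH.  Some y in xH has
    y^2 = 1, and an H-conjugate y' of y lies in R; as y' is still in xH, the
    quotient x^-1 y' is in the intersection P of R and H, so y' is in xP.
    Conversely suppose that P is a perfect code, and let x^2 be in H.  The
    Frattini argument moves x within xH into N_G(P), and raising to an odd power
    makes x a 2-element in the same coset; then x^2 is a 2-element of H that
    normalises P, so x^2 is in P, and xP contains a square root of 1. *)

(** * Inverse-closed transversals *)

(** The value is a boolean so that such a set of maximal size can be picked. *)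
Definition partial_transversal (gT : finGroupType) (G H S : {set gT}) : bool :=
  [&& S \subset G :\: H, S^-1 == S
    & [forall s in S, forall t in S, (s^-1 * t \in H) ==> (s == t)]].

Section Transversal.

Variables (gT : finGroupType) (G H : {group gT}).
Hypothesis sHG : H \subset G.

Implicit Types (S : {set gT}) (x y s t : gT).

Lemma partial_transversalP S :
  reflect [/\ S \subset G :\: H, S^-1 = S
            & {in S &, forall s t, s^-1 * t \in H -> s = t}]
          (partial_transversal G H S).
Proof.
apply: (iffP and3P) => [[sSG /eqP SV /forall_inP inj] | [sSG SV inj]].
  split=> // s t Ss St Hst.
  by have /forall_inP/(_ t St)/implyP/(_ Hst)/eqP := inj s Ss.
split=> //; first exact/eqP.
by apply/forall_inP=> s Ss; apply/forall_inP=> t St; apply/implyP=> /inj->.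
Qed.

Lemma perfect_code_transversal :
  perfect_code G H <->
  exists2 S : {set gT}, partial_transversal G H S & G :\: H \subset S * H.
Proof.
split=> [[S [sSG SV] [_ noHH uniq]] | [S /partial_transversalP[sSG SV inj] cov]].
  have memV x : (x^-1 \in S) = (x \in S) by rewrite -{2}SV inE.
  have notH s : s \in S -> s \notin H.
    move=> Ss; apply/negP=> Hs.
    by have := noHH _ _ (group1 H) Hs; rewrite /cayley_adj invg1 mulg1 Ss.
  have inG s : s \in S -> s \in G :\: H.
    by move=> Ss; rewrite inE notH //; have /setD1P[] := subsetP sSG _ Ss.
  exists S.
    apply/partial_transversalP; split=> //; first exact/subsetP.
    move=> s t Ss St Hst.
    (* s is adjacent both to 1 and to t^-1 s, which both lie in H *)
    have /eqP/cards1P[c defc] := uniq s (inG s Ss).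
    have: 1 \in [set c] by rewrite -defc !inE group1 /cayley_adj mul1g memV.
    have: t^-1 * s \in [set c].
      rewrite -defc !inE -groupV invMg invgK Hst /cayley_adj.
      by rewrite mulgK memV.
    rewrite !inE => /eqP <- /eqP/esym/(canRL (mulKVg t)).
    by rewrite mulg1.
  apply/subsetP=> x GHx; have /eqP/cards1P[c defc] := uniq x GHx.
  have: c \in [set c] by rewrite inE.
  rewrite -defc inE => /andP[Hc].
  rewrite /cayley_adj -memV invMg invgK => Sxc.
  by rewrite -(mulgKV c x); apply: mem_mulg.
have memV x : (x^-1 \in S) = (x \in S) by rewrite -{2}SV inE.
have notH s : s \in S -> s \notin H by move=> /(subsetP sSG)/setDP[].
exists S.
  split=> //; apply/subsetP=> s Ss; have /setDP[Gs H's] := subsetP sSG s Ss.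
  by rewrite !inE Gs andbT; apply: contraNneq H's => ->.
split=> // [x y Hx Hy | x GHx].
  by apply/negP=> /notH/negP; apply; rewrite groupM ?groupV.
have /mulsgP[s h Ss Hh ->] := subsetP cov x GHx.
apply/eqP/cards1P; exists h; apply/setP=> c; rewrite !inE /cayley_adj.
apply/andP/eqP=> [[Hc Sc] | ->]; last by rewrite invMg mulKVg memV.
have: s = (c * (s * h)^-1)^-1.
  apply: inj => //; first by rewrite memV.
  by rewrite invMg invgK -mulgA mulKg groupM ?groupV.
rewrite invMg invgK -mulgA -{1}(mulg1 s) => /mulgI/eqP.
by rewrite eq_sym -eq_mulgV1 => /eqP.
Qed.

Lemma partial_transversal_sub S s :
  partial_transversal G H S -> s \in S -> s^-1 = s ->
  partial_transversal G H (S :\ s).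
Proof.
move=> /partial_transversalP[sSG SV inj] Ss sV.
apply/partial_transversalP; split.
- exact: subset_trans (subsetDl _ _) sSG.
- by apply/setP=> x; rewrite !inE -{2}SV inE -{1}sV (inj_eq invg_inj).
- by move=> a b /setD1P[_ Sa] /setD1P[_ Sb]; apply: inj.
Qed.

(** The condition [t * t \notin H] says that t and t^-1 lie in different left
    cosets; they may share one only by being equal. *)
Lemma partial_transversal_add S t :
  partial_transversal G H S -> t \in G :\: H ->
  t \notin S * H -> t^-1 \notin S * H -> (t^-1 = t \/ t * t \notin H) ->
  partial_transversal G H (t |: (t^-1 |: S)).
Proof.
move=> /partial_transversalP[sSG SV inj] /setDP[Gt H't] nct nctV tt.
have far s u : s \in S -> u \notin S * H -> s^-1 * u \notin H.
  move=> Ss; apply: contra => Hsu.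
  by rewrite -(mulKVg s u); apply: mem_mulg.
have farV s u : s \in S -> u \notin S * H -> u^-1 * s \notin H.
  by move=> Ss /(far s u Ss); rewrite -groupV invMg invgK.
apply/partial_transversalP; split.
- by rewrite !subUset !sub1set sSG !inE !groupV Gt H't.
- apply/setP=> x; rewrite !inE -{2}SV inE (inj_eq invg_inj).
  by rewrite eq_invg_sym orbCA.
move=> a b; rewrite !inE.
move=> /or3P[/eqP->|/eqP->|Sa] /or3P[/eqP->|/eqP->|Sb] //.
- by case: tt => [->|/negPf tt] //; rewrite -invMg groupV tt.
- by rewrite (negPf (farV _ _ Sb nct)).
- by case: tt => [->|/negPf tt] //; rewrite invgK tt.
- by rewrite (negPf (farV _ _ Sb nctV)).
- by rewrite (negPf (far _ _ Sa nct)).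
- by rewrite (negPf (far _ _ Sa nctV)).
- exact: inj.
Qed.

(** * Parity in a double coset *)

Local Notation dcoset x := (H * (x *: H)).

Lemma dcosetP x y :
  reflect (exists h k, [/\ h \in H, k \in H & y = h * (x * k)])
          (y \in dcoset x).
Proof.
apply: (iffP mulsgP) => [[h _ Hh /lcosetP[k Hk ->] ->] | [h [k [Hh Hk ->]]]].
  by exists h, k.
by exists h (x * k) => //; rewrite mem_lcoset mulKg.
Qed.

Lemma dcoset_refl x : x \in dcoset x.
Proof. by apply/dcosetP; exists 1, 1; rewrite !group1 mulg1 mul1g. Qed.

Lemma dcoset_eq x y : y \in dcoset x -> dcoset y = dcoset x.
Proof.
case/dcosetP=> h [k [Hh Hk ->]].
by rewrite -!mulg_set1 -!mulgA (lcoset_id Hk) !mulgA (rcoset_id Hh).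
Qed.

Lemma dcosetV x : (dcoset x)^-1 = dcoset x^-1.
Proof. by rewrite !invMg !invGid -?mulgA ?invg_set1. Qed.

Lemma dcosetMr x : dcoset x * H = dcoset x.
Proof. by rewrite -!mulgA mulGid. Qed.

(** HxH is a left translate of H^x H, so it has [#|H : H :^ x|] left cosets. *)
Lemma card_dcoset x : #|dcoset x| = (#|H : H :^ x| * #|H|)%N.
Proof.
have -> : dcoset x = x *: (H :^ x * H).
  by rewrite conjsgE -!mulgA !mulgA mulg_set1 mulgV mul1g.
rewrite card_lcoset; apply/eqP.
rewrite -(eqn_pmul2r (cardG_gt0 (H :^ x :&: H))) -mul_cardG cardJg.
rewrite mulnAC -indexgI mulnC -[(_ * #|_ :&: _|)%N]mulnC setIC.
by rewrite Lagrange ?subsetIl.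
Qed.

Lemma dcosetI_mulG x S : (S :&: dcoset x) * H = (S * H) :&: dcoset x.
Proof.
have sDH : (S :&: dcoset x) * H \subset dcoset x * H.
  by rewrite mulSg ?subsetIr.
rewrite dcosetMr in sDH.
apply/eqP; rewrite eqEsubset subsetI sDH mulSg ?subsetIl //=.
apply/subsetP=> _ /setIP[/mulsgP[s h Ss Hh ->] Dsh]; apply: mem_mulg => //.
by rewrite inE Ss -(mulgK h s) -(dcosetMr x) mem_mulg ?groupV.
Qed.

Lemma card_partial_transversalM S :
  {in S &, forall s t, s^-1 * t \in H -> s = t} ->
  #|S * H| = (#|S| * #|H|)%N.
Proof.
move=> inj; rewrite -cardsX -[RHS](card_in_imset (f := uncurry mulg)).
  by rewrite -curry_imset2X.
case=> s h [t k] /setXP[/= Ss Hh] /setXP[/= St Hk] /= e.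
have est : s = t.
  apply: inj => //; have -> : s^-1 * t = h * k^-1.
    by apply: (mulgI s); apply: (mulIg k); rewrite mulKVg mulgA mulgKV.
  by rewrite groupM ?groupV.
by move: e; rewrite est => /mulgI->.
Qed.


Lemma card_transversal_dcoset x S : partial_transversal G H S ->
  #|(S * H) :&: dcoset x| = (#|S :&: dcoset x| * #|H|)%N.
Proof.
case/partial_transversalP=> _ _ inj.
rewrite -dcosetI_mulG card_partial_transversalM // => s t.
by move=> /setIP[Ss _] /setIP[St _]; apply: inj.
Qed.

(** Removing a pair {s, s^-1} does not change parity. *)
Lemma odd_invg_closed S :
  S^-1 = S -> odd #|S| -> exists2 s, s \in S & s^-1 = s.
Proof.
have [n] := ubnP #|S|; elim: n S => // n IHn S ltSn SV oddS.
have memV x : (x^-1 \in S) = (x \in S) by rewrite -{2}SV inE.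
have [s Ss] : exists s, s \in S by apply/card_gt0P; case: #|S| oddS.
have [sV | ne] := eqVneq s^-1 s; first by exists s.
have Tt : s^-1 \in S :\ s by rewrite !inE ne memV.
have cardS : #|S| = #|S :\ s :\ s^-1|.+2.
  by rewrite (cardsD1 s) Ss (cardsD1 s^-1) Tt.
have [||| u] := IHn (S :\ s :\ s^-1).
- by rewrite cardS !ltnS in ltSn; apply: ltnW.
- apply/setP=> x; rewrite !inE memV (inj_eq invg_inj) eq_invg_sym.
  by rewrite andbCA.
- by rewrite cardS /= negbK in oddS.
by rewrite !inE => /and3P[_ _ Su] uV; exists u.
Qed.

(** A transversal meets an inverse-closed double coset in an inverse-closed set,
    so an odd number of left cosets forces an involution. *)
Lemma perfect_code_dcoset_sqr x :
  perfect_code G H -> x \in G -> x^-1 \in dcoset x ->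
  odd #|H : H :^ x| -> exists2 y, y \in dcoset x & y * y = 1.
Proof.
move=> /perfect_code_transversal[S ptS cov] Gx xV oddD.
have [Hx | H'x] := boolP (x \in H).
  exists 1; last exact: mulg1.
  by apply/dcosetP; exists 1, x^-1; rewrite group1 groupV Hx mulgV mulg1.
have [sSG SV inj] := partial_transversalP _ ptS.
have covD : dcoset x \subset S * H.
  apply: subset_trans cov; apply/subsetP=> y /dcosetP[h [k [Hh Hk ->]]].
  by rewrite inE (groupMl _ Hh) (groupMr _ Hk) H'x !groupM // (subsetP sHG).
have [||s /setIP[Ss Ds] sV] := @odd_invg_closed (S :&: dcoset x).
- by rewrite invIg SV dcosetV (dcoset_eq xV).
- suffices -> : #|S :&: dcoset x| = #|H : H :^ x| by [].
  apply/eqP; rewrite -(eqn_pmul2r (cardG_gt0 H)) -card_dcoset.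
  by rewrite -card_transversal_dcoset // (setIidPr covD).
by exists s; rewrite // -{1}sV mulVg.
Qed.

(** A partial transversal S of maximal size covers every left coset.  Suppose
    xH is not covered and put D = HxH.  If a second left coset yH of HxH^-1 is
    uncovered, some t in xH has its inverse in yH, and {t, t^-1} can be added
    to S.  Otherwise D = D^-1, with xH the only uncovered left coset of D: if D
    and D^-1 were disjoint, D^-1 would be covered, and then D too, since S meets
    the two in inverse sets.  If S meets D in an odd number of elements,
    one of them is an involution s; replacing s by some t in sH with t^-1 in xH,
    and by t^-1, enlarges S.  If that number is even, the number of left cosets
    of D is odd, and the involution of D provided by the hypothesis is conjugate
    under H to one in xH, which can be added to S. *)
Lemma dcoset_sqr_perfect_code :
  (forall x, x \in G -> x^-1 \in dcoset x -> odd #|H : H :^ x| ->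
     exists2 y, y \in dcoset x & y * y = 1) ->
  perfect_code G H.
Proof.
move=> sqrD.
have pt0 : partial_transversal G H set0.
  apply/partial_transversalP; split; first exact: sub0set.
    by apply/setP=> x; rewrite !inE.
  by move=> s t; rewrite inE.
have [S ptS maxS] := arg_maxnP (fun S : {set gT} => #|S|) pt0.
apply/perfect_code_transversal; exists S => //.
apply/subsetP=> x GHx; have /setDP[Gx H'x] := GHx.
have [// | ncx] := boolP (x \in S * H); exfalso.
have [sSG SV inj] := partial_transversalP _ ptS.
have cosM u v : v \in u *: H -> (v \in S * H) = (u \in S * H).
  case/lcosetP=> h Hh ->; apply/idP/idP=> [suH | uH].
    by rewrite -(mulgK h u) -[H in S * H]mulGid mulgA mem_mulg ?groupV.
  by rewrite -[H in S * H]mulGid mulgA mem_mulg.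
have GHlc u v : v \in u *: H -> u \in G :\: H -> v \in G :\: H.
  case/lcosetP=> h Hh -> /setDP[Gu H'u].
  by rewrite inE (groupMr _ Hh) H'u groupM // (subsetP sHG).
have sub1 (T : {set gT}) : T \subset T * H.
  by rewrite -{1}(mulg1 T) mulgS // sub1set group1.
have maximal (T : {set gT}) : partial_transversal G H T -> S \proper T -> False.
  by move=> /maxS/=; rewrite leqNgt => /negP ge /proper_card /ge.
(* uH and Hv^-1 intersect, as do all left and right cosets of a double coset *)
have meet u v : v^-1 \in dcoset u -> exists2 t, t \in u *: H & t^-1 \in v *: H.
  case/dcosetP=> h [k [Hh Hk e]]; exists (u * k).
    by rewrite mem_lcoset mulKg.
  have -> : u * k = h^-1 * v^-1 by rewrite e mulKg.
  by rewrite invMg !invgK mem_lcoset mulKg.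
have proper_add t t' : t \notin S * H -> S \proper t |: (t' |: S).
  move=> nct; rewrite setUA properUr // subUset negb_and sub1set.
  by rewrite (contra (subsetP (sub1 S) t) nct).
have only y : y^-1 \in dcoset x -> y \notin S * H -> y \in x *: H.
  move=> /meet[t xt yt] ncy; apply/negPn/negP=> xH'y.
  have nct : t \notin S * H by rewrite (cosM _ _ xt).
  apply: maximal (proper_add t t^-1 nct); apply: partial_transversal_add => //.
  - exact: GHlc xt GHx.
  - by rewrite (cosM _ _ yt).
  right; apply: contra xH'y => Htt.
  have: t^-1 \in x *: H.
    by rewrite -(lcoset_eqP xt) mem_lcoset -invMg groupV.
  by move=> /lcoset_eqP <-; rewrite (lcoset_eqP yt) lcoset_refl.
have xHD y : y \in x *: H -> y \in dcoset x.
  by move=> xy; rewrite -(mul1g y) mem_mulg.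
have [xV | D'xV] := boolP (x^-1 \in dcoset x); last first.
  have covDV : dcoset x^-1 \subset S * H.
    apply/subsetP=> y DVy; apply: contraR D'xV => /only xy.
    have /xHD/dcoset_eq <- : y \in x *: H.
      by apply: xy; rewrite -mem_invg dcosetV.
    by rewrite (dcoset_eq DVy) dcoset_refl.
  have cardD : #|(S * H) :&: dcoset x| = #|dcoset x|.
    rewrite -[RHS]card_invg dcosetV -(setIidPr covDV) !card_transversal_dcoset //.
    by rewrite -dcosetV -{2}SV -invIg card_invg.
  have /eqP eD : (S * H) :&: dcoset x == dcoset x.
    by rewrite eqEcard subsetIr cardD leqnn.
  by have := dcoset_refl x; rewrite -eD inE (negPf ncx).
have uncovered : dcoset x :\: (S * H) = x *: H.
  apply/setP=> y; rewrite inE; apply/andP/idP=> [[ncy Dy] | xy].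
    by apply: only; rewrite // -mem_invg dcosetV (dcoset_eq xV).
  by rewrite (cosM _ _ xy) xHD.
have indexD : #|H : H :^ x| = #|S :&: dcoset x|.+1.
  apply/eqP; rewrite -(eqn_pmul2r (cardG_gt0 H)) -card_dcoset.
  rewrite -(cardsID (S * H)) uncovered setIC card_transversal_dcoset //.
  by rewrite card_lcoset -mulSnr.
have [oddS | evenS] := boolP (odd #|S :&: dcoset x|).
  have [| s /setIP[Ss Ds] sV] := odd_invg_closed _ oddS.
    by rewrite invIg SV dcosetV (dcoset_eq xV).
  have cs : s \in S * H by apply: subsetP (sub1 S) _ Ss.
  have [| t st xt] := meet s x; first by rewrite (dcoset_eq Ds).
  have nct : t \notin (S :\ s) * H.
    apply/mulsgP=> [[r h /setD1P[/eqP ne Sr] Hh e]]; apply: ne.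
    apply: inj => //; rewrite -mem_lcoset lcoset_sym -(lcoset_eqP st) e.
    by rewrite lcoset_sym mem_lcoset mulKg.
  have nctV : t^-1 \notin S * H by rewrite (cosM _ _ xt).
  have ntt : t * t \notin H.
    apply: contra nctV => Htt; rewrite (cosM s) //.
    by rewrite -(lcoset_eqP st) mem_lcoset -invMg groupV.
  have /maxS/= : partial_transversal G H (t |: (t^-1 |: S :\ s)).
    apply: partial_transversal_add => //.
    - exact: partial_transversal_sub.
    - exact: GHlc st (subsetP sSG s Ss).
    - by apply: contra nctV; apply: subsetP; rewrite mulSg ?subsetDl.
    by right.
  have ne : t != t^-1.
    by apply: contraNneq ntt => e; rewrite {2}e mulgV group1.
  have nt := contra (subsetP (sub1 _) t) nct.
  have ntV := contra (subsetP (sub1 S) _) nctV.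
  rewrite (cardsD1 s S) Ss cardsU1 cardsU1 in_setU1 negb_or nt in_setD1.
  by rewrite (negPf ntV) andbF /= ne !add1n ltnn.
have [|y /dcosetP[h [k [Hh Hk ->]]] yy] := sqrD x Gx xV.
  by rewrite indexD.
pose t := x * k * h.
have xt : t \in x *: H by rewrite mem_lcoset /t -mulgA mulKg groupM.
have nct : t \notin S * H by rewrite (cosM _ _ xt).
have tV : t^-1 = t.
  apply/eqP; rewrite eq_invg_mul; apply/eqP.
  by apply: (mulgI h); apply: (mulIg h^-1);
  rewrite mulg1 mulgV -yy /t !mulgA mulgK.
apply: maximal (proper_add t t^-1 nct); apply: partial_transversal_add => //.
- exact: GHlc xt GHx.
- by rewrite tV.
by left.
Qed.

Lemma perfect_code_dcoset :
  perfect_code G H <->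
  (forall x, x \in G -> x^-1 \in dcoset x -> odd #|H : H :^ x| ->
     exists2 y, y \in dcoset x & y * y = 1).
Proof.
split; last exact: dcoset_sqr_perfect_code.
by move=> pcH x Gx xV oddx; apply: perfect_code_dcoset_sqr.
Qed.

(** * Subgroups all of whose odd double cosets are single cosets *)

Lemma perfect_code_sqr :
  (forall x, x \in G -> odd #|H : H :^ x| -> x \in 'N(H)) ->
  perfect_code G H <->
  (forall x, x \in 'N_G(H) -> x * x \in H ->
     exists2 y, y \in x *: H & y * y = 1).
Proof.
move=> oddN.
have dcN x : x \in 'N(H) -> dcoset x = x *: H.
  by move=> Nx; rewrite mulgA norm_rlcoset // -mulgA mulGid.
have memV x : (x^-1 \in x *: H) = (x * x \in H).
  by rewrite mem_lcoset -invMg groupV.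
split=> [/perfect_code_dcoset sqrD x /setIP[Gx Nx] Hxx | sqrN].
  by rewrite -dcN //; apply: sqrD; rewrite // ?dcN ?memV ?(normP Nx) ?indexgg.
apply/perfect_code_dcoset=> x Gx xV oddx; have Nx := oddN x Gx oddx.
rewrite dcN //; apply: sqrN; first by rewrite in_setI Gx.
by rewrite -memV -dcN.
Qed.

End Transversal.

Lemma normal_perfect_code_sqr (gT : finGroupType) (G H : {group gT}) :
  H <| G ->
  perfect_code G H <->
  (forall x, x \in 'N_G(H) -> x * x \in H ->
     exists2 y, y \in x *: H & y * y = 1).
Proof.
case/andP=> sHG nHG; apply: perfect_code_sqr => // x Gx _.
exact: subsetP nHG x Gx.
Qed.

(** The index of P :&: P :^ x in P is a power of 2, so it is odd only when it
    is 1. *)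
Lemma pgroup2_perfect_code_sqr (gT : finGroupType) (G P : {group gT}) :
  P \subset G -> 2.-group P ->
  perfect_code G P <->
  (forall x, x \in 'N_G(P) -> x * x \in P ->
     exists2 y, y \in x *: P & y * y = 1).
Proof.
move=> sPG pP; apply: perfect_code_sqr => // x _.
rewrite odd_2'nat -indexgI => i2'.
have i2 : 2.-nat #|P : P :&: P :^ x| := pnat_dvd (dvdn_indexg _ _) pP.
have /eqP := pnat_1 i2 i2'; rewrite indexgI indexg_eq1 => sPPx.
by rewrite -groupV inE sub_conjgV.
Qed.

(** * Sylow subgroups of a normal subgroup *)

Lemma sqr_2elt (gT : finGroupType) (x : gT) : 2.-elt (x * x) -> 2.-elt x.
Proof.
have -> : x * x = x ^+ 2 by rewrite expgS expg1.
rewrite -[X in _ -> 2.-elt X]expg1 !p_elt_exp dvdn1 => dvd2.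
have : coprime 2 #[x]`_2^' by apply: pnat_coprime (part_pnat _ _).
by rewrite coprime_sym /coprime (gcdn_idPl dvd2).
Qed.

Lemma Sylow_norm_mem (gT : finGroupType) (H P : {group gT}) p (x : gT) :
  p.-Sylow(H) P -> x \in H -> x \in 'N(P) -> p.-elt x -> x \in P.
Proof.
move=> sylP Hx Nx px.
have sPN : P \subset 'N_H(P) by rewrite subsetI (pHall_sub sylP) normG.
have sylN := pHall_subl sPN (subsetIl _ _) sylP.
have nPN : P <| 'N_H(P) by rewrite /normal sPN subsetIr.
by rewrite (mem_normal_Hall sylN nPN) // in_setI Hx.
Qed.

(** The set R * H plays the role of H<x>: there R is a Sylow 2-subgroup, so a
    square root of 1 found in xH can be conjugated into R, and the
    conjugating element can be taken in H since R normalises itself. *)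
Lemma Sylow_perfect_code (gT : finGroupType) (G H P : {group gT}) :
  H <| G -> 2.-Sylow(H) P -> perfect_code G H -> perfect_code G P.
Proof.
move=> nHG sylP /(normal_perfect_code_sqr nHG) sqrH.
have sPH := pHall_sub sylP; have pP := pHall_pgroup sylP.
have [sHG NHG] := andP nHG.
apply/(pgroup2_perfect_code_sqr (subset_trans sPH sHG) pP).
move=> x /setIP[Gx NPx] Pxx.
have NHx := subsetP NHG x Gx.
have [||y xy yy] := sqrH x.
- by rewrite in_setI Gx.
- exact: subsetP Pxx.
pose R := (P <*> <[x]>)%G.
have xP : <[x]> \subset 'N(P) by rewrite cycle_subG.
have Rx : x \in R by rewrite mem_gen // inE cycle_id orbT.
have pR : 2.-group R.
  rewrite /R /= norm_joinEr // pgroupM pP /=; apply: sqr_2elt.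
  exact: mem_p_elt pP Pxx.
have sPR : P \subset R := joing_subl _ _.
have defP : H :&: R = P.
  apply: (sub_pHall sylP); last exact: subsetIl.
    exact: pgroupS (subsetIr _ _) pR.
  by rewrite subsetI sPH.
have nHR : R \subset 'N(H).
  by rewrite join_subG (subset_trans sPH (normG H)) cycle_subG.
have defK : R <*> H = R * H := norm_joinEl nHR.
have sylR : 2.-Sylow(R <*> H) R.
  rewrite /pHall joing_subl pR /= defK indexMg -indexgI defP.
  by have /and3P[] := sylP.
have [h Hh def_y] := lcosetP xy.
have p2y : 2.-elt y by apply: sqr_2elt; rewrite yy /p_elt order1.
have sYK : <[y]> \subset R <*> H by rewrite cycle_subG /= defK def_y mem_mulg.
have [k] := Sylow_subJ sylR sYK p2y.
rewrite /= defK cycle_subG => /mulsgP[r g Rr Hg ->].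
rewrite /= conjsgM (conjGid Rr) mem_conjg => Ryg.
exists (y ^ g^-1); last by rewrite -conjMg yy conj1g.
rewrite mem_lcoset -defP in_setI [_ \in R]groupM ?groupV // andbT.
rewrite def_y conjgE invgK.
have -> : x^-1 * (g * (x * h * g^-1)) = g ^ x * (h * g^-1).
  by rewrite conjgE !mulgA.
by rewrite groupM ?memJ_norm ?groupM ?groupV.
Qed.

Lemma perfect_code_of_Sylow (gT : finGroupType) (G H P : {group gT}) :
  H <| G -> 2.-Sylow(H) P -> perfect_code G P -> perfect_code G H.
Proof.
move=> nHG sylP.
have sPH := pHall_sub sylP; have pP := pHall_pgroup sylP.
have [sHG NHG] := andP nHG.
move=> /(pgroup2_perfect_code_sqr (subset_trans sPH sHG) pP) sqrP.
apply/(normal_perfect_code_sqr nHG) => x /setIP[Gx NHx] Hxx.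
have : x \in H * 'N_G(P) by rewrite (Frattini_arg nHG sylP).
case/mulsgP=> h n Hh /setIP[Gn NPn] def_x.
have NHn := subsetP NHG n Gn.
have xn : n \in x *: H.
  by rewrite mem_lcoset def_x invMg -mulgA -conjgE memJ_norm ?groupV.
have Hnn : n * n \in H.
  have -> : n * n = (h^-1 * (h^-1) ^ x^-1) * (x * x).
    by rewrite {1 2}(canRL (mulKg h) (esym def_x)) conjgE invgK !mulgA mulgKV.
  by rewrite groupM // groupM ?memJ_norm ?groupV.
(* n ^+ m is a 2-element, and it stays in n *: H because m is odd *)
pose m := (#[n]`_2^')%N.
have xu : n ^+ m \in x *: H.
  have odd_m : odd m by rewrite odd_2'nat part_pnat.
  rewrite -(lcoset_eqP xn) mem_lcoset -(odd_double_half m) odd_m.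
  by rewrite expgS mulKg -muln2 mulnC expgM groupX.
have p2u : 2.-elt (n ^+ m) by rewrite p_elt_exp.
have NPu : n ^+ m \in 'N(P) by rewrite groupX.
have Huu : n ^+ m * n ^+ m \in H by rewrite -expgMn // groupX.
have [||y uy yy] := sqrP (n ^+ m).
- by rewrite in_setI groupX.
- apply: Sylow_norm_mem sylP Huu _ _; first by rewrite groupM.
  by have := p_eltX 2 p2u; rewrite expgS expg1.
exists y => //; rewrite -(lcoset_eqP xu).
by apply: subsetP uy; rewrite mulgS.
Qed.

Theorem theorem5p1 (gT : finGroupType) (G H : {group gT})
    (metG : metabelian G) (nHG : H <| G) :
  perfect_code G H <->
  exists2 P : {group gT}, 2.-Sylow(H) P & perfect_code G P.
Proof.
split=> [pcH | [P sylP]]; last exact: perfect_code_of_Sylow.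
have [P sylP] := Sylow_exists 2 H.
by exists P => //; apply: Sylow_perfect_code pcH.
Qed.
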